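(* There are infinitely many complex numbers $z\neq 0$ with $e^z+e^{1/z}=1$. *)

(* Defs.v *)
From Stdlib Require Import Reals Factorial Lra Lia.
From Coquelicot Require Import Coquelicot.

Open Scope R_scope.

(* The complex exponential e^(x + iy) = e^x (cos y + i sin y), absent from
   Coquelicot. [Cexp_series] proves that it is the sum of z^n / n!. *)
Definition Cexp (z : C) : C :=
  (exp (Re z) * cos (Im z), exp (Re z) * sin (Im z)).

Lemma is_derive_Re_Cexp (w z : C) (t : R) :
  is_derive (fun t : R => Re (w * Cexp (t * z))%C) t
    (Re (w * z * Cexp (t * z))%C).
Proof.
destruct w as [a b]; destruct z as [x y].
apply is_derive_ext with (fun t =>
  a * (exp (t * x) * cos (t * y)) - b * (exp (t * x) * sin (t * y))).
{ intros s; unfold Cexp, Re, Im; simpl.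
  replace (s * x - 0 * y) with (s * x) by ring.
  now replace (s * y + 0 * x) with (s * y) by ring. }
unfold Cexp, Re, Im; simpl.
replace (t * x - 0 * y) with (t * x) by ring.
replace (t * y + 0 * x) with (t * y) by ring.
auto_derive; [easy|]; ring.
Qed.

Lemma is_derive_n_Re_Cexp (n : nat) (w z : C) (t : R) :
  is_derive_n (fun t : R => Re (w * Cexp (t * z))%C) n t
    (Re (w * z ^ n * Cexp (t * z))%C).
Proof.
revert t; induction n as [|n IHn]; intros t.
- change (Re (w * Cexp (t * z))%C = Re (w * RtoC 1 * Cexp (t * z))%C).
  now rewrite Cmult_1_r.
- apply (is_derive_ext (fun t : R => Re (w * z ^ n * Cexp (t * z))%C)).
  { intros s; symmetry; apply is_derive_n_unique, IHn. }
  replace (w * z ^ S n)%C with (w * z ^ n * z)%C by (rewrite Cpow_S; ring).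
  apply is_derive_Re_Cexp.
Qed.

Lemma Cmod_Cexp (z : C) : Cmod (Cexp z) = exp (Re z).
Proof.
unfold Cmod, Cexp; simpl.
replace (_ + _) with (exp (Re z) ^ 2 * (Rsqr (sin (Im z)) + Rsqr (cos (Im z))))
  by (unfold Rsqr; ring).
rewrite sin2_cos2, Rmult_1_r, sqrt_pow2; [easy|apply Rlt_le, exp_pos].
Qed.

Lemma exp_le_mono (x y : R) : x <= y -> exp x <= exp y.
Proof. intros [H| ->]; [apply Rlt_le, exp_increasing, H | apply Rle_refl]. Qed.

Lemma Re_Cexp_series (w z : C) :
  is_lim_seq (sum_n (fun n => Re (w * z ^ n)%C / INR (fact n)))
    (Re (w * Cexp z)%C).
Proof.
set (M := Cmod w * (Cmod z * exp (Rabs (Re z)))).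
apply is_lim_seq_spec; intros eps.
assert (Hlim : is_lim_seq (fun n => M * (Cmod z ^ n / INR (fact n))) 0).
{ replace (Finite 0) with (Rbar_mult M 0) by (simpl; f_equal; ring).
  apply is_lim_seq_scal_l, is_lim_seq_Reals, cv_speed_pow_fact. }
apply is_lim_seq_spec in Hlim.
destruct (Hlim eps) as [N HN]; exists N; intros n Hn.
specialize (HN n Hn); rewrite Rminus_0_r in HN.
destruct (Taylor_Lagrange (fun t : R => Re (w * Cexp (t * z))%C) n 0 1)
  as [s [Hs Heq]]; [lra| |].
{ intros t _ [|k] _; [exact I|].
  exists (Re (w * z ^ S k * Cexp (t * z))%C).
  apply (is_derive_n_Re_Cexp (S k)). } 
rewrite (is_derive_n_unique _ _ _ _ (is_derive_n_Re_Cexp _ w z s)) in Heq.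
rewrite Cmult_1_l in Heq; rewrite Heq, sum_n_Reals; clear Heq.
rewrite (sum_eq
  (fun m => _ / _ * Derive_n (fun t : R => Re (w * Cexp (t * z))%C) m 0)
  (fun m => Re (w * z ^ m)%C / INR (fact m))).
2:{ intros m _.
  rewrite (is_derive_n_unique _ _ _ _ (is_derive_n_Re_Cexp _ w z 0)).
  replace (Cexp (0 * z)) with (RtoC 1).
  - rewrite Cmult_1_r, Rminus_0_r, pow1; unfold Rdiv; ring.
  - unfold Cexp, Re, Im; simpl; rewrite !Rmult_0_l, Rminus_0_r, Rplus_0_r.
    now rewrite exp_0, cos_0, sin_0, Rmult_1_l, Rmult_0_r. }
rewrite Rabs_minus_sym, Rplus_minus_l, Rminus_0_r, pow1.
apply Rle_lt_trans with (2 := HN); rewrite !Rabs_mult.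
pose proof (INR_fact_lt_0 n) as Hn0; pose proof (INR_fact_lt_0 (S n)) as Hn1.
assert (H1 : Rabs (Re (w * z ^ S n * Cexp (s * z))%C)
             <= Cmod w * (Cmod z * exp (Rabs (Re z))) * Cmod z ^ n).
{ refine (Rle_trans _ _ _ (Rle_trans _ _ _ (Rmax_l _ _) (Rmax_Cmod _)) _).
  rewrite !Cmod_mult, Cmod_pow, Cmod_Cexp; simpl.
  assert (exp (s * Re z - 0 * Im z) <= exp (Rabs (Re z))).
  { apply exp_le_mono; rewrite Rmult_0_l, Rminus_0_r.
    apply Rle_trans with (1 := Rle_abs _); rewrite Rabs_mult, (Rabs_pos_eq s) by lra.
    pose proof (Rabs_pos (Re z)); nra. }
  replace (Cmod w * (Cmod z * exp (Rabs (Re z))) * Cmod z ^ n)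
    with (Cmod w * (Cmod z * Cmod z ^ n) * exp (Rabs (Re z))) by ring.
  apply Rmult_le_compat_l; [|assumption].
  apply Rmult_le_pos; [apply Cmod_ge_0|].
  apply Rmult_le_pos; [apply Cmod_ge_0|apply pow_le, Cmod_ge_0]. }
rewrite (Rabs_pos_eq (1 / _)).
2:{ apply Rlt_le, Rdiv_lt_0_compat; lra. }
apply Rle_trans with (/ INR (fact n) * (M * Cmod z ^ n)).
- apply Rmult_le_compat; try apply Rabs_pos.
  + apply Rlt_le, Rdiv_lt_0_compat; lra.
  + unfold Rdiv; rewrite Rmult_1_l; apply Rinv_le_contravar; [assumption|].
    apply le_INR, fact_le; lia.
  + exact H1.
- rewrite <- Rabs_mult; apply Rle_trans with (2 := Rle_abs _).
  unfold Rdiv; right; ring.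
Qed.

Lemma Cexp_series (z : C) :
  is_series (K := C_AbsRing) (V := C_NormedModule)
    (fun n => z ^ n / INR (fact n))%C (Cexp z).
Proof.
assert (HR := Re_Cexp_series 1 z); assert (HI := Re_Cexp_series (- Ci) z).
apply filterlim_locally. intros eps.
apply is_lim_seq_spec in HR, HI.
destruct (HR eps) as [N1 H1], (HI eps) as [N2 H2].
exists (max N1 N2); intros n Hn.
specialize (H1 n ltac:(lia)); specialize (H2 n ltac:(lia)).
assert (E : sum_n (G := C_AbelianMonoid) (fun n => z ^ n / INR (fact n))%C n
  = (sum_n (fun n => Re (1 * z ^ n)%C / INR (fact n)) n,
     sum_n (fun n => Re (- Ci * z ^ n)%C / INR (fact n)) n)).
{ assert (E0 : forall k, (z ^ k / INR (fact k))%C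
    = (Re (1 * z ^ k)%C / INR (fact k), Re (- Ci * z ^ k)%C / INR (fact k))).
  { intros k; pose proof (INR_fact_lt_0 k).
    destruct (z ^ k)%C as [a b]; unfold Cdiv.
    rewrite <- RtoC_inv by lra.
    apply injective_projections; simpl; unfold Rdiv; ring. }
  clear -E0; induction n as [|n IH].
  - rewrite !sum_O; apply E0.
  - rewrite !sum_Sn, IH, E0; reflexivity. }
change (ball (M := C_UniformSpace) (Cexp z) eps
  (sum_n (G := C_AbelianMonoid) (fun n => z ^ n / INR (fact n))%C n)).
rewrite E; split; simpl.
- replace (exp (Re z) * cos (Im z)) with (Re (1 * Cexp z)%C); [exact H1|].
  now rewrite Cmult_1_l.
- replace (exp (Re z) * sin (Im z)) with (Re (- Ci * Cexp z)%C); [exact H2|].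
  unfold Cexp, Re, Im; simpl; ring.
Qed.

(* Main.v *)
Require Import Defs.
From Stdlib Require Import Reals Finite_sets Lra.
From Coquelicot Require Import Coquelicot.

(** For large z the equation f z = e^z + e^(1/z) - 1 = 0 is a small perturbation
    of e^z = -1/z, because e^(1/z) - 1 is close to 1/z. The latter has an
    approximate solution in every period strip of the exponential: if
    Y = pi/2 + 2 k pi and z0 = - ln Y + i Y, then e^z0 = i/Y, while
    -1/z0 = i/Y + O(ln Y / Y^2). So f z0 is much smaller than 1/Y
    ([approximate_zero_value]), whereas near z0 the map f behaves like its
    linear part with slope c = e^z0, of modulus 1/Y: on the disk of radius 1/4
    about z0, f z - c z is Lipschitz with constant at most |c|/2. Hence the
    simplified Newton map z - f z / c contracts this disk into itself, and its
    fixed point is an exact zero ([zero_near_approximate_zero],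
    [zero_of_large_Im]). The zeros so obtained have unbounded imaginary parts
    as k grows, which no finite set allows.

    The Lipschitz estimates all come from one mean value inequality for the
    complex exponential ([Cexp_mean_value]). *)

Open Scope R_scope.

(** * Contractions of a complex disk *)

Lemma Cmod_minus_sym (x y : C) : Cmod (x - y) = Cmod (y - x).
Proof. rewrite <- Cmod_opp; f_equal; ring. Qed.

Lemma Cmod_triangle_mid (x y m : C) : Cmod (x - y) <= Cmod (x - m) + Cmod (m - y).
Proof.
replace (x - y)%C with ((x - m) + (m - y))%C by ring; apply Cmod_triangle.
Qed.

Lemma Im_le_Cmod (z : C) : Rabs (Im z) <= Cmod z.
Proof. exact (Rle_trans _ _ _ (Rmax_r _ _) (Rmax_Cmod z)). Qed.

Lemma is_lim_seq_0_le (u : nat -> R) (a : R) :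
  is_lim_seq u 0 -> (forall n, a <= u n) -> a <= 0.
Proof.
intros Hu Ha; apply (is_lim_seq_le (fun _ => a) u a 0 Ha); auto.
apply is_lim_seq_const.
Qed.

(** The increments form a series dominated by a geometric one, which converges
    since C is complete; its partial sums are u (n + 1) - u 0. *)
Lemma Cmod_cauchy_geom (u : nat -> C) (M q : R) :
  0 <= q < 1 -> (forall n, Cmod (u (S n) - u n) <= M * q ^ n) ->
  exists l : C, is_lim_seq (fun n => Cmod (u n - l)) 0.
Proof.
intros Hq Hu.
destruct (ex_series_le (K := C_AbsRing) (V := C_CompleteNormedModule)
  (fun n => u (S n) - u n)%C (fun n => M * q ^ n)) as [s Hs].
- exact Hu.
- apply (ex_series_scal (K := R_AbsRing) (V := R_NormedModule) M
    (fun n => q ^ n)), ex_series_geom.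
  rewrite Rabs_pos_eq; lra.
- exists (s + u 0%nat)%C; apply is_lim_seq_incr_1, is_lim_seq_spec; intros eps.
  assert (E : forall n, sum_n (G := C_AbelianMonoid)
    (fun n => u (S n) - u n)%C n = (u (S n) - u 0%nat)%C).
  { intros n; induction n as [|n IH]; [now rewrite sum_O|].
    rewrite sum_Sn, IH.
    change (u (S n) - u 0%nat + (u (S (S n)) - u (S n)) = u (S (S n)) - u 0%nat)%C.
    ring. }
  generalize (proj1 (filterlim_locally_ball_norm (K := C_AbsRing)
    (U := C_CompleteNormedModule) _ _) Hs eps).
  apply filter_imp; intros n Hn.
  rewrite Rminus_0_r, Rabs_pos_eq by apply Cmod_ge_0.
  replace (u (S n) - (s + u 0%nat))%C with (u (S n) - u 0%nat - s)%C by ring.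
  rewrite <- E; exact Hn.
Qed.

(** A 1/2-contraction T that moves the centre by at most half the radius keeps
    the disk stable, so the iterates of T from the centre stay in it and
    converge to a fixed point. *)
Lemma Banach_fixed_point_C (T : C -> C) (z0 : C) (r : R) :
  (forall z z', Cmod (z - z0) <= r -> Cmod (z' - z0) <= r ->
     Cmod (T z - T z') <= / 2 * Cmod (z - z')) ->
  Cmod (T z0 - z0) <= r / 2 ->
  exists z, Cmod (z - z0) <= r /\ T z = z.
Proof.
intros HT H0.
assert (Hr : 0 <= r) by (pose proof (Cmod_ge_0 (T z0 - z0)); lra).
assert (H00 : Cmod (z0 - z0) <= r).
{ replace (z0 - z0)%C with (RtoC 0) by ring; rewrite Cmod_0; lra. }
set (u := fun n => Nat.iter n T z0).
assert (Hball : forall n, Cmod (u n - z0) <= r).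
{ induction n as [|n IH]; [exact H00|].
  pose proof (Cmod_triangle_mid (T (u n)) z0 (T z0)).
  pose proof (HT (u n) z0 IH H00); change (u (S n)) with (T (u n)); lra. }
destruct (Cmod_cauchy_geom u (r / 2) (/ 2)) as [l Hl]; [lra| |].
{ induction n as [|n IH]; [rewrite Rmult_1_r; exact H0|].
  pose proof (HT _ _ (Hball (S n)) (Hball n)).
  change (u (S (S n))) with (T (u (S n))); change (u (S n)) with (T (u n)) at 2.
  simpl pow; lra. }
assert (Hlr : Cmod (l - z0) <= r).
{ cut (Cmod (l - z0) - r <= 0); [lra|]; apply (is_lim_seq_0_le _ _ Hl); intros n.
  pose proof (Cmod_triangle_mid l z0 (u n)); pose proof (Hball n).
  rewrite (Cmod_minus_sym l (u n)) in H; lra. }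
exists l; split; [exact Hlr|].
assert (E : Cmod (T l - l) <= 0).
{ apply (is_lim_seq_0_le (fun n => / 2 * Cmod (u n - l) + Cmod (u (S n) - l))).
  - replace (Finite 0) with (Finite (/ 2 * 0 + 0)) by (f_equal; ring).
    apply is_lim_seq_plus'; [|now apply -> is_lim_seq_incr_1 in Hl].
    now apply (is_lim_seq_scal_l _ (/ 2) 0).
  - intros n; pose proof (Cmod_triangle_mid (T l) l (u (S n))).
    pose proof (HT _ _ Hlr (Hball n)); rewrite (Cmod_minus_sym l) in H1.
    change (T (u n)) with (u (S n)) in H1; lra. }
replace (T l) with (T l - l + l)%C by ring.
rewrite (Cmod_eq_0 (T l - l)); [ring|].
pose proof (Cmod_ge_0 (T l - l)); lra.
Qed.

(** Simplified Newton method: the hypothesis on f says exactly that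
    z - f z / c is a 1/2-contraction of the disk, and its fixed points are the
    zeros of f. *)
Lemma zero_near_approximate_zero (f : C -> C) (c z0 : C) (r : R) :
  c <> 0 ->
  (forall z z', Cmod (z - z0) <= r -> Cmod (z' - z0) <= r ->
     Cmod (f z - f z' - c * (z - z')) <= Cmod c / 2 * Cmod (z - z')) ->
  Cmod (f z0) <= Cmod c * r / 2 ->
  exists z, Cmod (z - z0) <= r /\ f z = 0.
Proof.
intros Hc Hf H0; pose proof (proj1 (Cmod_gt_0 c) Hc) as Hc'.
destruct (Banach_fixed_point_C (fun z => z - f z / c)%C z0 r) as [z [Hz E]].
- intros z z' Hz Hz'.
  replace (z - f z / c - (z' - f z' / c))%C
    with (- (f z - f z' - c * (z - z')) / c)%C by (field; exact Hc).
  rewrite Cmod_div, Cmod_opp by exact Hc.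
  apply Rle_div_l; [exact Hc'|].
  pose proof (Hf z z' Hz Hz'); lra.
- replace (z0 - f z0 / c - z0)%C with (- (f z0) / c)%C by (field; exact Hc).
  rewrite Cmod_div, Cmod_opp by exact Hc.
  apply Rle_div_l; [exact Hc'|lra].
- exists z; split; [exact Hz|].
  replace (f z) with (c * (z - (z - f z / c)))%C by (field; exact Hc).
  rewrite E; ring.
Qed.

(** * Lipschitz estimates for the complex exponential *)

Lemma Cexp_plus (a b : C) : Cexp (a + b) = (Cexp a * Cexp b)%C.
Proof.
unfold Cexp, Cmult, Re, Im; simpl; rewrite exp_plus, cos_plus, sin_plus.
apply injective_projections; simpl; ring.
Qed.

Lemma Cexp_0 : Cexp 0 = 1.
Proof.
unfold Cexp; simpl; rewrite exp_0, cos_0, sin_0; apply injective_projections; simpl; ring.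
Qed.

Lemma Re_minus (x y : C) : Re (x - y)%C = Re x - Re y.
Proof. reflexivity. Qed.

Lemma Re_scal (t : R) (x : C) : Re (t * x)%C = t * Re x.
Proof. unfold Re; simpl; ring. Qed.

(** The mean value theorem fails for complex-valued functions, so it is applied
    to a real one: with D the difference to be bounded, the function
    t |-> Re (conj D * (e^(b + t h) - c t h)) grows by |D|^2 on [0, 1], and its
    derivative is at most |D| |h| K. *)
Lemma Cexp_mean_value (b h c : C) (K : R) :
  (forall t : R, 0 <= t <= 1 -> Cmod (Cexp (b + t * h) - c) <= K) ->
  Cmod (Cexp (b + h) - Cexp b - c * h) <= K * Cmod h.
Proof.
intros HK; set (D := (Cexp (b + h) - Cexp b - c * h)%C).
set (w := Cconj D).
set (phi := fun t : R => Re (w * (Cexp (b + t * h) - c * (t * h)))%C).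
assert (Hd : forall t, is_derive phi t (Re (w * h * (Cexp (b + t * h) - c))%C)).
{ intros t.
  apply (is_derive_ext (fun t : R =>
    Re (w * Cexp b * Cexp (t * h))%C - t * Re (w * c * h)%C)).
  { intros s; unfold phi; rewrite Cexp_plus; symmetry.
    replace (w * (Cexp b * Cexp (s * h) - c * (s * h)))%C
      with (w * Cexp b * Cexp (s * h) - s * (w * c * h))%C by ring.
    now rewrite Re_minus, Re_scal. }
  replace (Re (w * h * (Cexp (b + t * h) - c))%C)
    with (Re (w * Cexp b * h * Cexp (t * h))%C - Re (w * c * h)%C).
  2:{ rewrite Cexp_plus, <- Re_minus; f_equal; ring. }
  apply (is_derive_minus (K := R_AbsRing) (V := R_NormedModule)).
  - apply is_derive_Re_Cexp.
  - generalize (Re (w * c * h)%C); intros a; auto_derive; [easy|ring]. }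
destruct (MVT_gen phi 0 1 _ (fun x _ => Hd x)) as [s [Hs E]].
{ intros x _; apply derivable_continuous_pt.
  apply ex_derive_Reals_0; eexists; apply Hd. }
rewrite Rmin_left, Rmax_right in Hs by lra.
assert (ED : phi 1 - phi 0 = Cmod D * Cmod D).
{ replace (Cmod D * Cmod D) with (Cmod D ^ 2) by ring.
  rewrite Cmod2_alt; unfold phi, w.
  replace (b + 1 * h)%C with (b + h)%C by ring.
  replace (b + 0 * h)%C with b by ring.
  unfold D; unfold Re, Im; simpl; ring. }
rewrite ED, Rminus_0_r, Rmult_1_r in E.
pose proof (Rle_abs (Re (w * h * (Cexp (b + s * h) - c))%C)).
pose proof (re_le_Cmod (w * h * (Cexp (b + s * h) - c))%C) as H1.
rewrite !Cmod_mult in H1; unfold w in H1 at 2; rewrite Cmod_conj in H1.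
pose proof (HK s Hs); pose proof (Cmod_ge_0 D); pose proof (Cmod_ge_0 h).
assert (H5 : Cmod D * Cmod D <= Cmod D * (K * Cmod h)).
{ rewrite E at 1.
  apply Rle_trans with (1 := H), Rle_trans with (1 := H1).
  rewrite Rmult_assoc; apply Rmult_le_compat_l; [assumption|].
  rewrite Rmult_comm; apply Rmult_le_compat_r; assumption. }
destruct (Req_dec (Cmod D) 0) as [HD|HD].
- rewrite HD; apply Rmult_le_pos; [|assumption].
  exact (Rle_trans _ _ _ (Cmod_ge_0 _) H0).
- apply (Rmult_le_reg_l (Cmod D)); lra.
Qed.

Lemma Re_le_Cmod (z : C) : Re z <= Cmod z.
Proof. exact (Rle_trans _ _ _ (Rle_abs _) (re_le_Cmod z)). Qed.

Lemma Cmod_segment_le (b h : C) (t M : R) :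
  0 <= t <= 1 -> Cmod b <= M -> Cmod (b + h) <= M -> Cmod (b + t * h) <= M.
Proof.
intros Ht Hb Hh.
replace (b + t * h)%C with (RtoC (1 - t) * b + RtoC t * (b + h))%C
  by (rewrite RtoC_minus; ring).
eapply Rle_trans; [apply Cmod_triangle|].
rewrite !Cmod_mult, !Cmod_R, !Rabs_pos_eq by lra; nra.
Qed.

Lemma Cexp_Lipschitz (a b : C) (M : R) :
  Cmod a <= M -> Cmod b <= M -> Cmod (Cexp a - Cexp b) <= exp M * Cmod (a - b).
Proof.
intros Ha Hb.
replace (Cexp a - Cexp b)%C with (Cexp (b + (a - b)) - Cexp b - 0 * (a - b))%C
  by (replace (b + (a - b))%C with a by ring; ring).
apply Cexp_mean_value; intros t Ht.
replace (Cexp (b + t * (a - b)) - 0)%C with (Cexp (b + t * (a - b))) by ring.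
rewrite Cmod_Cexp; apply exp_le_mono, Rle_trans with (1 := Re_le_Cmod _).
apply Cmod_segment_le; auto; now replace (b + (a - b))%C with a by ring.
Qed.

(** Cexp - id has slope e^s - 1 at s, and |e^s - 1| <= e^M M for |s| <= M. *)
Lemma Cexp_near_identity (a b : C) (M : R) :
  Cmod a <= M -> Cmod b <= M ->
  Cmod (Cexp a - Cexp b - (a - b)) <= exp M * M * Cmod (a - b).
Proof.
intros Ha Hb.
replace (Cexp a - Cexp b - (a - b))%C
  with (Cexp (b + (a - b)) - Cexp b - 1 * (a - b))%C
  by (replace (b + (a - b))%C with a by ring; ring).
apply Cexp_mean_value; intros t Ht.
assert (H : Cmod (b + t * (a - b)) <= M).
{ apply Cmod_segment_le; auto; now replace (b + (a - b))%C with a by ring. }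
rewrite <- Cexp_0.
eapply Rle_trans; [apply (Cexp_Lipschitz _ _ M H)|].
- rewrite Cmod_0; exact (Rle_trans _ _ _ (Cmod_ge_0 _) Ha).
- replace (b + t * (a - b) - 0)%C with (b + t * (a - b))%C by ring.
  apply Rmult_le_compat_l; [apply Rlt_le, exp_pos|exact H].
Qed.

(** * Zeros near the points - ln Y + i Y *)

Lemma ln_le_div_16 (Y : R) : 1024 <= Y -> 0 <= ln Y <= Y / 16.
Proof.
intros HY; split.
- rewrite <- ln_1; apply ln_le; lra.
- rewrite <- (ln_exp (Y / 16)).
  (* e^(Y/16) = (e^(Y/32))^2 >= (1 + Y/32)^2 >= Y, as Y >= 32^2. *)
  apply ln_le; [lra|].
  replace (Y / 16) with (Y / 32 + Y / 32) by field; rewrite exp_plus.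
  pose proof (exp_ineq1_le (Y / 32)); nra.
Qed.

(** Inverting 1 - 1/4 <= e^(-1/4). *)
Lemma exp_quarter_le : exp (/ 4) <= 4 / 3.
Proof.
pose proof (exp_ineq1_le (- / 4)) as H; rewrite exp_Ropp in H.
pose proof (exp_pos (/ 4)) as H0.
assert (E : / exp (/ 4) * exp (/ 4) = 1) by (field; lra).
nra.
Qed.

Lemma Cmod_inv_le (z : C) (m : R) : 0 < m -> m <= Cmod z -> Cmod (1 / z) <= / m.
Proof.
intros Hm Hz.
assert (Hz0 : z <> 0) by (apply Cmod_gt_0; lra).
rewrite Cmod_div, Cmod_1 by exact Hz0.
unfold Rdiv; rewrite Rmult_1_l; apply Rinv_le_contravar; assumption.
Qed.

(** Here 1/z - 1/z' = (1/z) (1/z') (z' - z), and e^1 <= 3 on the unit disk. *)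
Lemma Cexp_inv_Lipschitz (z z' : C) (m : R) :
  1 <= m -> m <= Cmod z -> m <= Cmod z' ->
  Cmod (Cexp (1 / z) - Cexp (1 / z')) <= 3 / m ^ 2 * Cmod (z - z').
Proof.
intros Hm Hz Hz'.
assert (H : z <> 0) by (apply Cmod_gt_0; lra).
assert (H' : z' <> 0) by (apply Cmod_gt_0; lra).
pose proof (Cmod_inv_le z m ltac:(lra) Hz) as Hi.
pose proof (Cmod_inv_le z' m ltac:(lra) Hz') as Hi'.
assert (Hm1 : / m <= 1) by (rewrite <- Rinv_1; apply Rinv_le_contravar; lra).
eapply Rle_trans; [apply (Cexp_Lipschitz _ _ 1); lra|].
replace (1 / z - 1 / z')%C with ((1 / z) * (1 / z') * (z' - z))%C
  by (field; split; assumption).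
rewrite !Cmod_mult, (Cmod_minus_sym z').
replace (3 / m ^ 2 * Cmod (z - z')) with (3 * (/ m * / m * Cmod (z - z')))
  by (field; lra).
pose proof exp_le_3.
apply Rmult_le_compat; try (apply Rlt_le, exp_pos); try assumption.
- repeat apply Rmult_le_pos; apply Cmod_ge_0.
- apply Rmult_le_compat_r; [apply Cmod_ge_0|].
  apply Rmult_le_compat; try apply Cmod_ge_0; assumption.
Qed.

(** With z0 = - ln Y + i Y, the value is the sum of
    i/Y + 1/z0 = - i (ln Y) / (Y z0), bounded by (ln Y) / Y^2, and of
    e^(1/z0) - 1 - 1/z0, bounded by 3 / Y^2. *)
Lemma approximate_zero_value (Y : R) :
  1024 <= Y ->
  Cmod (Ci / Y + Cexp (1 / (- ln Y, Y)) - 1) <= / Y / 8.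
Proof.
intros HY; set (z0 := (- ln Y, Y) : C); pose proof (ln_le_div_16 Y HY) as HL.
assert (HYz : Y <= Cmod z0).
{ apply Rle_trans with (2 := Im_le_Cmod z0), Rle_abs. }
assert (Hz0 : z0 <> 0) by (apply Cmod_gt_0; lra).
assert (HYC : RtoC Y <> 0) by (intros H; apply RtoC_inj in H; lra).
pose proof (Cmod_inv_le z0 Y ltac:(lra) HYz) as Hi.
assert (HYi : 0 < / Y <= / 1024).
{ split; [apply Rinv_0_lt_compat; lra|apply Rinv_le_contravar; lra]. }
assert (HYY : / Y * Y = 1) by (field; lra).
replace (Ci / Y + Cexp (1 / z0) - 1)%C with
  (- Ci * ln Y / Y * (1 / z0) + (Cexp (1 / z0) - Cexp 0 - (1 / z0 - 0)))%C.
2:{ rewrite Cexp_0.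
  replace (- Ci * ln Y)%C with (Ci * z0 + Y)%C.
  - field; split; assumption.
  - unfold z0, Ci; apply injective_projections; simpl; ring. }
eapply Rle_trans; [apply Cmod_triangle|].
assert (H1 : Cmod (- Ci * ln Y / Y * (1 / z0)) <= / 16 * / Y).
{ rewrite Cmod_mult, Cmod_div, Cmod_mult, Cmod_opp, Cmod_Ci, !Cmod_R by assumption.
  rewrite !Rabs_pos_eq, Rmult_1_l by lra.
  apply Rmult_le_compat; [|apply Cmod_ge_0| |assumption].
  - apply Rmult_le_pos; lra.
  - unfold Rdiv; nra. }
assert (H2 := Cexp_near_identity (1 / z0) 0 (/ Y) Hi ltac:(rewrite Cmod_0; lra)).
replace (1 / z0 - 0)%C with (1 / z0)%C in * by ring.
assert (He : exp (/ Y) <= 3).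
{ apply Rle_trans with (2 := exp_le_3), exp_le_mono; lra. }
pose proof (exp_pos (/ Y)).
assert (exp (/ Y) * / Y * Cmod (1 / z0) <= 3 * / Y * / Y).
{ apply Rmult_le_compat; [nra|apply Cmod_ge_0|nra|assumption]. }
nra.
Qed.

(** The slope is c = e^z0 = i/Y. Writing e^z = c e^(z - z0), the map
    e^z - c z has Lipschitz constant at most |c|/3 on the disk of radius 1/4,
    and e^(1/z) contributes at most 12/Y^2 <= |c|/6; together this is the
    required |c|/2. *)
Lemma zero_of_large_Im (Y : R) :
  1024 <= Y -> cos Y = 0 -> sin Y = 1 ->
  exists z : C, Y - / 4 <= Im z /\ z <> 0 /\ (Cexp z + Cexp (1 / z) = 1)%C.
Proof.
intros HY Hcos Hsin; set (z0 := (- ln Y, Y) : C).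
assert (HYC : RtoC Y <> 0) by (intros H; apply RtoC_inj in H; lra).
assert (Hc : Cexp z0 = (Ci / Y)%C).
{ unfold Cexp, z0; simpl; rewrite Hcos, Hsin, exp_Ropp, exp_ln by lra.
  unfold Cdiv; rewrite <- RtoC_inv by lra.
  apply injective_projections; simpl; ring. }
assert (Hmc : Cmod (Ci / Y) = / Y).
{ rewrite Cmod_div, Cmod_Ci, Cmod_R, Rabs_pos_eq by (lra || assumption).
  unfold Rdiv; ring. }
assert (HYi : 0 < / Y <= / 1024).
{ split; [apply Rinv_0_lt_compat; lra|apply Rinv_le_contravar; lra]. }
assert (HIm : forall z, Cmod (z - z0) <= / 4 -> Y - / 4 <= Im z).
{ intros z Hz; pose proof (Rle_trans _ _ _ (Im_le_Cmod (z - z0)) Hz) as H.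
  apply Rabs_le_between in H; unfold z0, Im in *; simpl in *; lra. }
assert (HY2 : forall z, Cmod (z - z0) <= / 4 -> Y / 2 <= Cmod z).
{ intros z Hz; pose proof (HIm z Hz).
  pose proof (Rle_trans _ _ _ (Rle_abs _) (Im_le_Cmod z)); lra. }
destruct (zero_near_approximate_zero
  (fun z => Cexp z + Cexp (1 / z) - 1)%C (Ci / Y) z0 (/ 4)) as [z [Hz E]].
- apply Cmod_gt_0; lra.
- intros z z' Hz Hz'; rewrite Hmc.
  replace (Cexp z + Cexp (1 / z) - 1 - (Cexp z' + Cexp (1 / z') - 1)
      - Ci / Y * (z - z'))%C with
    (Ci / Y * (Cexp (z - z0) - Cexp (z' - z0) - ((z - z0) - (z' - z0)))
      + (Cexp (1 / z) - Cexp (1 / z')))%C.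
  2:{ replace (Cexp z) with (Ci / Y * Cexp (z - z0))%C.
      replace (Cexp z') with (Ci / Y * Cexp (z' - z0))%C.
      ring.
      all: rewrite <- Hc, <- Cexp_plus; f_equal; ring. }
  eapply Rle_trans; [apply Cmod_triangle|]; rewrite Cmod_mult, Hmc.
  assert (H1 := Cexp_near_identity _ _ _ Hz Hz').
  assert (H2 := Cexp_inv_Lipschitz z z' (Y / 2) ltac:(lra) (HY2 z Hz) (HY2 z' Hz')).
  replace (z - z0 - (z' - z0))%C with (z - z')%C in * by ring.
  pose proof exp_quarter_le; pose proof (Cmod_ge_0 (z - z')) as Hd.
  assert (H3 : 3 / (Y / 2) ^ 2 <= / 6 * / Y).
  { (* 12/Y <= 1/6 holds from Y = 72 on. *)
    replace (3 / (Y / 2) ^ 2) with (12 * / Y * / Y) by (field; lra); nra. }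
  assert (H4 : exp (/ 4) * / 4 * Cmod (z - z') <= / 3 * Cmod (z - z')) by nra.
  assert (H5 := Rmult_le_compat_r _ _ _ Hd H3).
  assert (H6 := Rmult_le_compat_l (/ Y) _ _ ltac:(lra) (Rle_trans _ _ _ H1 H4)).
  lra.
- rewrite Hmc, Hc; pose proof (approximate_zero_value Y HY) as H0.
  fold z0 in H0; lra.
- exists z; split; [exact (HIm z Hz)|split].
  + apply Cmod_gt_0; pose proof (HY2 z Hz); lra.
  + replace (Cexp z + Cexp (1 / z))%C
      with (Cexp z + Cexp (1 / z) - 1 + 1)%C by ring.
    rewrite E; ring.
Qed.

(** * Infinitely many zeros *)

Lemma Finite_Im_bounded (A : C -> Prop) :
  Finite_sets.Finite C A -> exists M, forall z, A z -> Im z <= M.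
Proof.
induction 1 as [|A _ [M HM] x _].
- exists 0; intros z [].
- exists (Rmax M (Im x)); intros z [y Hy|y Hy].
  + exact (Rle_trans _ _ _ (HM y Hy) (Rmax_l _ _)).
  + destruct Hy; apply Rmax_r.
Qed.

Theorem mainTheorem4 :
  ~ Finite_sets.Finite C
      (fun z : C => (z <> 0 /\ Cexp z + Cexp (1 / z) = 1)%C).
Proof.
intros HF; destruct (Finite_Im_bounded _ HF) as [M HM].
destruct (INR_unbounded (Rmax M 1024)) as [k Hk].
pose proof (Rmax_l M 1024); pose proof (Rmax_r M 1024).
pose proof PI2_3_2.
set (Y := PI / 2 + 2 * INR k * PI).
assert (HY : INR k + / 4 <= Y) by (unfold Y; nra).
destruct (zero_of_large_Im Y) as [z [HIm Hz]].
- lra.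
- unfold Y; rewrite cos_period; apply cos_PI2.
- unfold Y; rewrite sin_period; apply sin_PI2.
- pose proof (HM z Hz); lra.
Qed.
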